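(* Let $\rho$ (density), $\mathbf{V}$ (velocity) and $p$ (pressure) satisfy the observable continuity and momentum equations $$\frac{\partial\rho}{\partial t}+\overline{\rho}\,\mathrm{div}\,\mathbf{V}+\overline{\mathbf{V}}\cdot\mathrm{grad}\,\rho=0,\qquad \frac{\partial(\rho\mathbf{V})}{\partial t}+\overline{\rho\mathbf{V}}\,\mathrm{div}\,\mathbf{V}+\overline{\mathbf{V}}\cdot\mathrm{grad}(\rho\mathbf{V})=-\nabla p.$$ If the density $\rho$ is a (positive) constant, then the continuity equation reduces to $\mathrm{div}\,\mathbf{V}=0$ and the momentum equation reduces to the inviscid Leray equation $$\frac{\partial\mathbf{V}}{\partial t}+\overline{\mathbf{V}}\cdot\mathrm{grad}\,\mathbf{V}=-\frac{1}{\rho}\nabla p.$$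
   Context: Here $\overline{(\cdot)}$ denotes spatial averaging by convolution, $\overline{f}=g*f$, with a kernel $g$ on $\mathbb{R}^3$ satisfying $\int g=1$, $g(\mathbf{x})>0$ for all $\mathbf{x}$, $|\mathbf{x}_1|\ge|\mathbf{x}_2|\Rightarrow g(\mathbf{x}_1)\le g(\mathbf{x}_2)$, and $|\mathbf{x}_1|=|\mathbf{x}_2|\Rightarrow g(\mathbf{x}_1)=g(\mathbf{x}_2)$; vector fields are averaged componentwise. The expression $\overline{\mathbf{V}}\cdot\mathrm{grad}$ applied to a vector field acts on each component. The functions are assumed regular enough for all terms to be defined classically. *)

(* Defs.v *)
From HB Require Import structures.
From mathcomp Require Import all_boot all_order all_algebra.
From mathcomp Require Import all_classical all_reals all_analysis.
Set Implicit Arguments.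
Unset Strict Implicit.
Unset Printing Implicit Defensive.
Import Order.TTheory GRing.Theory Num.Theory.
Import numFieldNormedType.Exports.
Local Open Scope classical_set_scope.
Local Open Scope ring_scope.

(* A field on space-time is a function of the time t : R and of the position
   x : 'rV[R]_3.  The time t ranges over an open subset J of R. *)

(* The canonical norm of 'rV[R]_3 is the sup norm. *)
Definition euclid (R : realType) (x : 'rV[R]_3) : R :=
  Num.sqrt (\sum_(i < 3) x 0 i ^+ 2).

(* 'rV[R]_3 carries no Lebesgue measure in the library: integrals over R^3 are
   taken on R * R * R, with the product measure, through these coordinates. *)
Definition point3 (R : realType) (y : R * R * R) : 'rV[R]_3 :=
  \row_(i < 3) nth 0 [:: y.1.1; y.1.2; y.2] i.

Definition lebesgue3 (R : realType) :
    {measure set (measurableTypeR R * measurableTypeR R * measurableTypeR R)%type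
       -> \bar R} :=
  ((@lebesgue_measure R \x @lebesgue_measure R) \x @lebesgue_measure R)%E.

Record averaging_kernel (R : realType) (g : 'rV[R]_3 -> R) : Prop := {
  kernel_integrable :
    (@lebesgue3 R).-integrable setT (fun y => (g (point3 y))%:E) ;
  kernel_unit : \int[@lebesgue3 R]_y g (point3 y) = 1 ;
  kernel_gt0 : forall x, 0 < g x ;
  kernel_noninc : forall x1 x2, euclid x2 <= euclid x1 -> g x1 <= g x2 ;
  kernel_radial : forall x1 x2, euclid x1 = euclid x2 -> g x1 = g x2 }.

(* (g * f)(x) = \int g(y) f(x - y) dy *)
Definition avg (R : realType) (g f : 'rV[R]_3 -> R) (x : 'rV[R]_3) : R :=
  \int[@lebesgue3 R]_y (g (point3 y) * f (x - point3 y)).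

Definition averageable (R : realType) (g f : 'rV[R]_3 -> R) : Prop :=
  forall x, (@lebesgue3 R).-integrable setT
    (fun y => (g (point3 y) * f (x - point3 y))%:E).

Definition vavg (R : realType) (g : 'rV[R]_3 -> R) (F : 'rV[R]_3 -> 'rV[R]_3)
    (x : 'rV[R]_3) : 'rV[R]_3 :=
  \row_(i < 3) avg g (fun z => F z 0 i) x.

Definition unitv (R : realType) (i : 'I_3) : 'rV[R]_3 := delta_mx 0 i.

Definition partial (R : realType) (i : 'I_3) (f : 'rV[R]_3 -> R)
    (x : 'rV[R]_3) : R := 'D_(unitv R i) f x.

Definition grad (R : realType) (f : 'rV[R]_3 -> R) (x : 'rV[R]_3) : 'rV[R]_3 :=
  \row_(i < 3) partial i f x.

Definition divergence (R : realType) (F : 'rV[R]_3 -> 'rV[R]_3)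
    (x : 'rV[R]_3) : R :=
  \sum_(i < 3) partial i (fun z => F z 0 i) x.

(* (u . grad) f, for a vector u *)
Definition advect (R : realType) (u : 'rV[R]_3) (f : 'rV[R]_3 -> R)
    (x : 'rV[R]_3) : R := \sum_(i < 3) u 0 i * grad f x 0 i.

Definition vadvect (R : realType) (u : 'rV[R]_3) (F : 'rV[R]_3 -> 'rV[R]_3)
    (x : 'rV[R]_3) : 'rV[R]_3 :=
  \row_(j < 3) advect u (fun z => F z 0 j) x.

Definition dt (R : realType) (W : normedModType R) (F : R -> 'rV[R]_3 -> W)
    (t : R) (x : 'rV[R]_3) : W := derive1 (fun s => F s x) t.

Definition momentum (R : realType) (rho : R -> 'rV[R]_3 -> R)
    (V : R -> 'rV[R]_3 -> 'rV[R]_3) (t : R) (x : 'rV[R]_3) : 'rV[R]_3 :=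
  rho t x *: V t x.

Definition space_derivable (R : realType) (f : 'rV[R]_3 -> R) : Prop :=
  forall x i, derivable f x (unitv R i).

(* All the time derivatives, first partial derivatives and averages that occur
   in the equations below exist. *)
Record regular_fields (R : realType) (J : set R) (g : 'rV[R]_3 -> R)
    (rho : R -> 'rV[R]_3 -> R) (V : R -> 'rV[R]_3 -> 'rV[R]_3)
    (p : R -> 'rV[R]_3 -> R) : Prop := {
  rho_dt : forall t x, J t -> derivable (fun s => rho s x) t 1 ;
  rho_dx : forall t, J t -> space_derivable (rho t) ;
  rho_avg : forall t, J t -> averageable g (rho t) ;
  V_dt : forall t x, J t -> derivable (fun s => V s x) t 1 ;
  V_dx : forall t i, J t -> space_derivable (fun z => V t z 0 i) ;
  V_avg : forall t i, J t -> averageable g (fun z => V t z 0 i) ;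
  rhoV_dt : forall t x, J t -> derivable (fun s => momentum rho V s x) t 1 ;
  rhoV_dx : forall t i, J t ->
    space_derivable (fun z => momentum rho V t z 0 i) ;
  rhoV_avg : forall t i, J t ->
    averageable g (fun z => momentum rho V t z 0 i) ;
  p_dx : forall t, J t -> space_derivable (p t) }.

Definition observable_continuity (R : realType) (J : set R)
    (g : 'rV[R]_3 -> R) (rho : R -> 'rV[R]_3 -> R)
    (V : R -> 'rV[R]_3 -> 'rV[R]_3) : Prop :=
  forall t x, J t ->
    dt rho t x + avg g (rho t) x * divergence (V t) x
    + advect (vavg g (V t) x) (rho t) x = 0.

Definition observable_momentum (R : realType) (J : set R)
    (g : 'rV[R]_3 -> R) (rho : R -> 'rV[R]_3 -> R)
    (V : R -> 'rV[R]_3 -> 'rV[R]_3) (p : R -> 'rV[R]_3 -> R) : Prop :=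
  forall t x, J t ->
    dt (momentum rho V) t x
    + divergence (V t) x *: vavg g (momentum rho V t) x
    + vadvect (vavg g (V t) x) (momentum rho V t) x = - grad (p t) x.

Definition divergence_free (R : realType) (J : set R)
    (V : R -> 'rV[R]_3 -> 'rV[R]_3) : Prop :=
  forall t x, J t -> divergence (V t) x = 0.

Definition inviscid_leray (R : realType) (J : set R) (g : 'rV[R]_3 -> R)
    (c : R) (V : R -> 'rV[R]_3 -> 'rV[R]_3) (p : R -> 'rV[R]_3 -> R) : Prop :=
  forall t x, J t ->
    dt V t x + vadvect (vavg g (V t) x) (V t) x = - (c^-1 *: grad (p t) x).

(* Main.v *)
Require Import Defs.
From mathcomp Require Import all_boot all_order all_algebra.
From mathcomp Require Import all_classical all_reals all_analysis.
Import Order.TTheory GRing.Theory Num.Theory.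
Import numFieldNormedType.Exports.
Local Open Scope classical_set_scope.
Local Open Scope ring_scope.

(** Averaging fixes constants because the kernel has unit mass ([avg_cst]), and time and space
    derivatives of a constant vanish. So for density [c] the left side of the continuity equation is
    exactly [c * divergence (V t) x], and [c != 0] gives the first equivalence. Once the divergence
    is zero, the middle term of the momentum equation drops out; the two remaining terms are linear
    in the momentum [c *: V] ([dtZ], [vadvectZ]), so [c] factors out and dividing by it gives the
    Leray equation. Each step is reversible. *)

Lemma avg_cst (R : realType) (g : 'rV[R]_3 -> R) (c : R) (x : 'rV[R]_3) :
  averaging_kernel g -> avg g (cst c) x = c.
Proof.
move=> hg; rewrite /avg RintegralZr//; last exact: kernel_integrable.
by rewrite kernel_unit// mul1r.
Qed.

Lemma advect_cst (R : realType) (u : 'rV[R]_3) (c : R) (x : 'rV[R]_3) :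
  advect u (cst c) x = 0.
Proof.
by rewrite /advect big1// => i _; rewrite mxE /partial derive_cst mulr0.
Qed.

Lemma vadvectZ (R : realType) (u : 'rV[R]_3) (c : R)
    (F : 'rV[R]_3 -> 'rV[R]_3) (x : 'rV[R]_3) :
  (forall j, space_derivable (fun z => F z 0 j)) ->
  vadvect u (fun z => c *: F z) x = c *: vadvect u F x.
Proof.
move=> dF; apply/rowP => j; rewrite !mxE /advect mulr_sumr.
apply: eq_bigr => i _; rewrite !mxE /partial.
under eq_fun do rewrite mxE.
by rewrite (deriveZ c (dF j x i)) mulrCA.
Qed.

(** A derivative depends only on values near [t], and the open set [J] is a neighbourhood of [t].
    This lets the density, known to be constant only at times in [J], be replaced by [c] under
    [dt]. *)
Lemma dt_near (R : realType) (W : normedModType R) (J : set R)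
    (F G : R -> 'rV[R]_3 -> W) (t : R) (x : 'rV[R]_3) :
  open J -> J t -> (forall s, J s -> F s x = G s x) -> dt F t x = dt G t x.
Proof.
move=> oJ Jt FG; rewrite /dt !derive1E; apply: near_eq_derive.
have : nbhs t J by apply: open_nbhs_nbhs.
by apply: filterS => s /FG.
Qed.

Lemma dt_cst (R : realType) (W : normedModType R) (w : W) (t : R)
    (x : 'rV[R]_3) : dt (fun _ _ => w) t x = 0.
Proof. by rewrite /dt derive1E derive_cst. Qed.

Lemma dtZ (R : realType) (W : normedModType R) (c : R)
    (F : R -> 'rV[R]_3 -> W) (t : R) (x : 'rV[R]_3) :
  derivable (fun s => F s x) t 1 ->
  dt (fun s y => c *: F s y) t x = c *: dt F t x.
Proof. by move=> dF; rewrite /dt !derive1E (deriveZ c dF). Qed.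

Theorem mainTheorem3 (R : realType) (J : set R) (g : 'rV[R]_3 -> R)
    (rho : R -> 'rV[R]_3 -> R) (V : R -> 'rV[R]_3 -> 'rV[R]_3)
    (p : R -> 'rV[R]_3 -> R) (c : R)
    (hJ : open J) (hg : averaging_kernel g)
    (hreg : regular_fields J g rho V p)
    (hc : 0 < c) (hrho : forall t x, J t -> rho t x = c) :
  (observable_continuity J g rho V <-> divergence_free J V) /\
  (observable_continuity J g rho V ->
     (observable_momentum J g rho V p <-> inviscid_leray J g c V p)).
Proof.
have rhoE t : J t -> rho t = cst c by move=> Jt; apply/funext => x; exact: hrho.
have c0 : c != 0 by rewrite gt_eqF.
have continuityE t x : J t ->
    dt rho t x + avg g (rho t) x * divergence (V t) x
    + advect (vavg g (V t) x) (rho t) x = c * divergence (V t) x.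
  move=> Jt; rewrite (@dt_near R _ J _ (fun _ _ => c) t x hJ Jt) => [|s Js].
    by rewrite dt_cst rhoE// avg_cst// advect_cst add0r addr0.
  exact: hrho.
(* The term carrying the averaged momentum is left out: its factor [divergence (V t) x] will be
   zero. *)
have momentumE t x : J t ->
    dt (momentum rho V) t x + vadvect (vavg g (V t) x) (momentum rho V t) x
    = c *: (dt V t x + vadvect (vavg g (V t) x) (V t) x).
  move=> Jt.
  rewrite (@dt_near R _ J _ (fun s y => c *: V s y) t x hJ Jt) => [|s Js].
    have -> : momentum rho V t = fun z => c *: V t z.
      by apply/funext => z; rewrite /momentum hrho.
    rewrite dtZ; last exact: V_dt hreg _ _ Jt.
    by rewrite vadvectZ ?scalerDr// => j; exact: V_dx hreg _ _ Jt.
  by rewrite /momentum hrho.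
have continuity_iff : observable_continuity J g rho V <-> divergence_free J V.
  split=> h t x Jt; last by rewrite continuityE// h// mulr0.
  by apply: (mulfI c0); rewrite -continuityE// h// mulr0.
split=> // /continuity_iff divV; split=> h t x Jt.
  (* Scaling the Leray equation by [c] turns its right side into [- grad (p t) x], since
     [c * c^-1 = 1]. *)
  apply: (scalerI c0); rewrite -momentumE// scalerN scalerA divff// scale1r.
  by rewrite -h// divV// scale0r addr0.
by rewrite divV// scale0r addr0 momentumE// h// scalerN scalerA divff// scale1r.
Qed.
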